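(* Let $(\mathscr{B},|\cdot|)$ be an ultrametric Banach algebra with a continuous derivation $d:\mathscr{B}\to\mathscr{B}$ of operator norm $|d|$, and let $(M,\nabla)$ be a differential module over $(\mathscr{B},d)$ of rank $n$ with basis $\mathbf{e}=\{e_0,\ldots,e_{n-1}\}$. Assume that $(n-1)!$ is invertible in $\mathscr{B}$ and that there is an element $t\in\mathscr{B}$ with $d(t)=1$. Let $G_1\in M_n(\mathscr{B})$ be the matrix of $\nabla$ in the basis $\mathbf{e}$, and let $|G_1|$ be its sup-norm. Assume that $$|G_1|\;<\;|H_0(t)|^{-2}\cdot\min\Bigl(1,\frac{1}{|d|^{2n-3}}\Bigr)\;=\;\min\Bigl(1,\frac{1}{|t|},\frac{|2|}{|t^2|},\ldots,\frac{|(n-1)!|}{|t^{n-1}|}\Bigr)^2\cdot\min\Bigl(1,\frac{1}{|d|^{2n-3}}\Bigr).$$ Then $(M,\nabla)$ is cyclic, and the Katz vector $c_0(\mathbf{e},t)$ is a cyclic vector for $M$.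
   Context: An ultrametric norm on a commutative unital ring $\mathscr{B}$ is a map $|\cdot|:\mathscr{B}\to\mathbb{R}_{\ge 0}$ with $|0|=0$, $|1|=1$, $|a+b|\le\max(|a|,|b|)$, $|ab|\le|a||b|$ for all $a,b\in\mathscr{B}$, and moreover $|na|=|n||a|$ for all $n\in\mathbb{Z}$, $a\in\mathscr{B}$ (where $|n|:=|n\cdot 1|$). An ultrametric Banach algebra is such a ring that is complete and separated ($|a|=0$ implies $a=0$) for $|\cdot|$. The norm is not assumed multiplicative. A derivation $d$ of $\mathscr{B}$ is a $\mathbb{Z}$-linear map with $d(ab)=ad(b)+d(a)b$. Its operator norm is $|d|:=\sup_{b\neq0}|d(b)|/|b|$, which is a finite real number. A differential module $(M,\nabla)$ of rank $n$ over $(\mathscr{B},d)$ is a free $\mathscr{B}$-module $M$ of finite rank $n$ with a $\mathbb{Z}$-linear map $\nabla:M\to M$ such that $\nabla(bm)=d(b)m+b\nabla(m)$ for $b\in\mathscr{B}$, $m\in M$. A cyclic vector is an element $m\in M$ such that $\{m,\nabla(m),\ldots,\nabla^{n-1}(m)\}$ is a basis of $M$ over $\mathscr{B}$; $M$ is cyclic if it has a cyclic vector. The matrix $G_1=(g_{i,j})_{i,j=0,\ldots,n-1}$ is defined by $\nabla(e_i)=\sum_{j=0}^{n-1}g_{i,j}e_j$. The sup-norm of a matrix is $|(a_{i,j})|:=\sup_{i,j}|a_{i,j}|$. $H_0(t)\in M_n(\mathscr{B})$ is the upper triangular matrix with $(i,j)$ entry $t^{j-i}/(j-i)!$ for $0\le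 i\le j\le n-1$ and $0$ for $j<i$; $|H_0(t)|$ is its sup-norm. The Katz vector is $$c_0(\mathbf{e},t)=\sum_{j=0}^{n-1}\frac{t^j}{j!}\sum_{k=0}^{j}(-1)^k\binom{j}{k}\nabla^k(e_{j-k}).$$ *)

(* Defs.v *)
From HB Require Import structures.
From mathcomp Require Import all_boot all_order all_algebra.
From mathcomp Require Import all_classical all_reals.

Set Implicit Arguments.
Unset Strict Implicit.
Unset Printing Implicit Defensive.

Import Order.TTheory GRing.Theory Num.Theory.

Local Open Scope classical_set_scope.
Local Open Scope ring_scope.

(* MathComp's normedZmodType requires `|x *+ n| = `|x| *+ n, which no
   ultrametric norm satisfies, so the norm is a plain function nm : B -> R. *)
Record ultrametric_norm (R : realType) (B : comUnitRingType) (nm : B -> R) :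
    Prop := UltrametricNorm {
  unorm_ge0 : forall a, 0 <= nm a;
  unorm0 : nm 0 = 0;
  unorm1 : nm 1 = 1;
  unormD : forall a b, nm (a + b) <= Num.max (nm a) (nm b);
  unormM : forall a b, nm (a * b) <= nm a * nm b;
  unormMz : forall (k : int) a, nm (a *~ k) = nm k%:~R * nm a
}.

Definition norm_cauchy (R : realType) (B : comUnitRingType) (nm : B -> R)
    (u : nat -> B) : Prop :=
  forall eps : R, 0 < eps -> exists N : nat, forall p q : nat,
    (N <= p)%N -> (N <= q)%N -> nm (u p - u q) < eps.

Definition norm_cvg (R : realType) (B : comUnitRingType) (nm : B -> R)
    (u : nat -> B) (l : B) : Prop :=
  forall eps : R, 0 < eps -> exists N : nat, forall p : nat,
    (N <= p)%N -> nm (u p - l) < eps.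

Record ultrametric_banach (R : realType) (B : comUnitRingType) (nm : B -> R) :
    Prop := UltrametricBanach {
  banach_norm : ultrametric_norm nm;
  banach_separated : forall a, nm a = 0 -> a = 0;
  banach_complete : forall u, norm_cauchy nm u -> exists l, norm_cvg nm u l
}.

Definition derivation (B : comUnitRingType) (d : {additive B -> B}) : Prop :=
  forall a b, d (a * b) = a * d b + d a * b.

Definition norm_continuous (R : realType) (B : comUnitRingType) (nm : B -> R)
    (d : B -> B) : Prop :=
  forall (a : B) (eps : R), 0 < eps -> exists2 delta : R, 0 < delta &
    forall b, nm (b - a) < delta -> nm (d b - d a) < eps.

Definition opnorm_set (R : realType) (B : comUnitRingType) (nm : B -> R)
    (d : B -> B) : set R :=
  [set nm (d b) / nm b | b in [set b : B | b != 0]].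

(* sup is 0 on a set unbounded above: opnorm is meaningful only together with
   has_ubound (opnorm_set nm d). *)
Definition opnorm (R : realType) (B : comUnitRingType) (nm : B -> R)
    (d : B -> B) : R :=
  sup (opnorm_set nm d).

(* Continuity alone does not bound the ratios nm (d b) / nm b (nm may induce
   the discrete topology and still be unbounded), so finiteness of |d| is a
   separate clause. *)
Definition continuous_derivation (R : realType) (B : comUnitRingType)
    (nm : B -> R) (d : {additive B -> B}) : Prop :=
  [/\ derivation d, norm_continuous nm d & has_ubound (opnorm_set nm d)].

Definition is_basis (B : comUnitRingType) (M : lmodType B) (n : nat)
    (e : 'I_n -> M) : Prop :=
  forall m : M, exists! c : {ffun 'I_n -> B}, m = \sum_(i < n) c i *: e i.

Definition connection (B : comUnitRingType) (M : lmodType B)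
    (d : {additive B -> B}) (nabla : {additive M -> M}) : Prop :=
  forall (b : B) (m : M), nabla (b *: m) = d b *: m + b *: nabla m.

Definition cyclic_vector (B : comUnitRingType) (M : lmodType B) (n : nat)
    (nabla : {additive M -> M}) (m : M) : Prop :=
  is_basis (fun i : 'I_n => iter i nabla m).

Definition cyclic_module (B : comUnitRingType) (M : lmodType B) (n : nat)
    (nabla : {additive M -> M}) : Prop :=
  exists m : M, cyclic_vector n nabla m.

Definition connection_matrix (B : comUnitRingType) (M : lmodType B) (n : nat)
    (nabla : {additive M -> M}) (e : 'I_n -> M) (G : 'M[B]_n) : Prop :=
  forall i : 'I_n, nabla (e i) = \sum_(j < n) G i j *: e j.

Definition mx_supnorm (R : realType) (B : comUnitRingType) (nm : B -> R)
    (n : nat) (A : 'M[B]_n) : R :=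
  \big[Num.max/0]_(i < n) \big[Num.max/0]_(j < n) nm (A i j).

Definition H0 (B : comUnitRingType) (n : nat) (t : B) : 'M[B]_n :=
  \matrix_(i < n, j < n)
    if (i <= j)%N then t ^+ (j - i) / ((j - i)`!)%:R else 0.

Definition ord_subn (n : nat) (j : 'I_n) (k : nat) : 'I_n :=
  Ordinal (leq_ltn_trans (leq_subr k j) (ltn_ord j)).

Definition katz_vector (B : comUnitRingType) (M : lmodType B) (n : nat)
    (nabla : {additive M -> M}) (e : 'I_n -> M) (t : B) : M :=
  \sum_(j < n) (t ^+ j / (j`!)%:R) *:
    \sum_(k < j.+1)
      ((-1) ^+ k * ('C(j, k))%:R) *: iter k nabla (e (ord_subn j k)).

(* Main.v *)
Require Import Defs.
From HB Require Import structures.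
From mathcomp Require Import all_boot all_order all_algebra.
From mathcomp Require Import all_classical all_reals.
From mathcomp Require Import fingroup perm ring zify.

Set Implicit Arguments.
Unset Strict Implicit.
Unset Printing Implicit Defensive.

Import Order.TTheory GRing.Theory Num.Theory.

Local Open Scope classical_set_scope.
Local Open Scope ring_scope.

(* The vectors c(i,j) = sum_k (-1)^k C(j,k) nabla^k(e_(i+j-k)), with e_m = 0 for
   m >= n, satisfy nabla c(i,j) = c(i+1,j) - c(i,j+1).  Since d(t^j/j!) =
   t^(j-1)/(j-1)!, applying nabla to sum_(j<n) t^j/j! c(i,j) telescopes to the
   same sum for i+1, up to the boundary term -t^(n-1)/(n-1)! c(i,n).  As c(i,j)
   is e_(i+j) up to terms nabla^k(e_m) with k >= 1, the matrix of the iterates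
   nabla^i(c_0), i < n, is H_0(t) + E with
     |E| <= |H_0(t)| |G_1| max(1,|d|)^(2n-3).
   The smallness hypothesis says |H_0(t)| |E| < 1, so H_0(-t)(H_0(t) + E) =
   1 + H_0(-t)E has determinant at distance < 1 from 1, which is a unit by
   completeness. *)

(** * Consequences of the norm axioms, up to determinants of matrices close to the identity *)

Section UltrametricNorm.

Variables (R : realType) (B : comUnitRingType) (nm : B -> R).
Hypothesis hnm : ultrametric_norm nm.

Let nm_ge0 : forall a, 0 <= nm a := unorm_ge0 hnm.
Let nm0 : nm 0 = 0 := unorm0 hnm.
Let nm1 : nm 1 = 1 := unorm1 hnm.

(** Multiplicativity on integers gives $|-1|^2=1$; submultiplicativity alone would give only
    $|-1|\ge 1$. *)
Lemma unormN1 : nm (-1) = 1.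
Proof.
have /esym/eqP : nm 1 = nm (-1) * nm (-1).
  by rewrite -(unormMz hnm (-1) (-1)) mulrN1z opprK.
by rewrite -expr2 nm1 sqrp_eq1 => [/eqP|].
Qed.

Lemma unormN a : nm (- a) = nm a.
Proof. by rewrite -mulrN1z (unormMz hnm) mulrN1z unormN1 mul1r. Qed.

Lemma unormMn a k : nm (a *+ k) = nm k%:R * nm a.
Proof. by have := unormMz hnm k a; rewrite !pmulrn. Qed.

Lemma unormD_le (C : R) a b : nm a <= C -> nm b <= C -> nm (a + b) <= C.
Proof.
move=> ha hb; apply: le_trans (unormD hnm a b) _.
by rewrite ge_max ha hb.
Qed.

Lemma unorm_sum_le (I : Type) (r : seq I) (P : pred I) (F : I -> B) (C : R) :
  0 <= C -> (forall i, P i -> nm (F i) <= C) -> nm (\sum_(i <- r | P i) F i) <= C.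
Proof.
move=> C0 hF; elim/big_rec: _ => [|i x Pi hx]; first by rewrite nm0.
by apply: unormD_le => //; apply: hF.
Qed.

Lemma unormM_le (C D : R) a b :
  nm a <= C -> nm b <= D -> nm (a * b) <= C * D.
Proof. by move=> ha hb; apply: le_trans (unormM hnm a b) _; rewrite ler_pM. Qed.

Lemma unormX_le a (r : R) k : nm a <= r -> nm (a ^+ k) <= r ^+ k.
Proof.
move=> ha; elim: k => [|k IH]; first by rewrite !expr0 nm1.
by rewrite !exprS unormM_le.
Qed.

Lemma unorm_nat_le1 k : nm k%:R <= 1.
Proof.
elim: k => [|k IH]; first by rewrite nm0 ler01.
by rewrite -addn1 natrD unormD_le // nm1.
Qed.

Lemma unorm_prod_le1 (I : Type) (r : seq I) (P : pred I) (F : I -> B) :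
  (forall i, P i -> nm (F i) <= 1) -> nm (\prod_(i <- r | P i) F i) <= 1.
Proof.
move=> hF; elim/big_rec: _ => [|i x Pi hx]; first by rewrite nm1.
by rewrite -[leRHS]mulr1; apply: unormM_le => //; apply: hF.
Qed.

Lemma unorm_prod1_sub1 (I : Type) (s : seq I) (P : pred I) (F : I -> B) (r : R) :
  0 <= r -> r <= 1 -> (forall i, P i -> nm (F i - 1) <= r) ->
  nm (\prod_(i <- s | P i) F i - 1) <= r.
Proof.
move=> r0 r1 hF; elim/big_rec: _ => [|i x Pi hx]; first by rewrite subrr nm0.
(* In this splitting the product of the two small terms has norm at most $r^2\le r$. *)
have -> : F i * x - 1 = (F i - 1) * (x - 1) + ((F i - 1) + (x - 1)).
  by ring.
have hi := hF i Pi.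
apply: unormD_le; last by apply: unormD_le.
by apply: le_trans (unormM_le hi hx) _; rewrite ler_piMl.
Qed.

(** In the Leibniz expansion the identity permutation gives a product of factors close to 1. Any
    other permutation moves some [i], hence picks up an off-diagonal entry of norm at most [r], and
    its other entries have norm at most 1. *)
Lemma unorm_det1_sub1 n (A : 'M[B]_n) (r : R) :
  0 <= r -> r <= 1 -> (forall i j, nm (A i j - (i == j)%:R) <= r) ->
  nm (\det A - 1) <= r.
Proof.
move=> r0 r1 hA.
have A1 i j : nm (A i j) <= 1.
  rewrite -[A i j](subrK (i == j)%:R) unormD_le ?unorm_nat_le1 //.
  exact: le_trans (hA i j) r1.
rewrite /determinant (bigD1 (1%g : 'S_n)) //= odd_perm1 mul1r addrAC.
apply: unormD_le.
  apply: unorm_prod1_sub1 => // i _.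
  by have := hA i i; rewrite perm1 eqxx.
apply: unorm_sum_le => // s s1.
have [i si] : exists i, s i != i.
  apply/existsP; apply: contraNT s1; rewrite negb_exists => /forallP hs.
  by apply/eqP/permP => i; rewrite perm1; apply/eqP; have := hs i; rewrite negbK.
have -> : nm ((-1) ^+ s * \prod_k A k (s k)) = nm (\prod_k A k (s k)).
  by case: (s : bool); rewrite ?expr1 ?expr0 ?mulN1r ?mul1r ?unormN.
rewrite (bigD1 i) //= -[leRHS]mulr1 unormM_le ?unorm_prod_le1 //.
by have := hA i (s i); rewrite eq_sym (negPf si) subr0.
Qed.

(** General products are only submultiplicative, but [unormMz] is an equality, so multiplying back
    by $j!$ loses nothing. *)
Lemma unorm_div_fact j a : (j`!)%:R \is a @GRing.unit B ->
  nm (j`!)%:R * nm (a / (j`!)%:R) = nm a.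
Proof. by move=> uj; rewrite -unormMn -[(a / _) *+ _]mulr_natr divrK. Qed.

End UltrametricNorm.

(** * Geometric series and units close to 1 *)

Lemma exprn_lt_eps (R : realType) (r eps : R) : 0 <= r -> r < 1 -> 0 < eps ->
  exists N, forall p, (N <= p)%N -> r ^+ p < eps.
Proof.
move=> r0 r1 eps0; set y := ((1 - r) * eps)^-1.
have r1' : 0 < 1 - r by rewrite subr_gt0.
have y0 : 0 < y by rewrite invr_gt0 mulr_gt0.
exists (Num.bound y) => p hp.
have yp : y < p%:R.
  by apply: lt_le_trans (archi_boundP (ltW y0)) _; rewrite ler_nat.
have p0 : 0 < p%:R :> R by apply: lt_trans yp.
(* Each $r^i$ with $i<p$ is at least $r^p$, and their sum is $(1-r^p)/(1-r)$. *)
have h : p%:R * r ^+ p * (1 - r) <= 1.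
  have : 1 - r ^+ p <= 1 by rewrite gerBl exprn_ge0.
  rewrite -opprB subrX1 -mulNr opprB [X in X <= _ -> _]mulrC.
  apply: le_trans; rewrite ler_pM2r //.
  have -> : p%:R * r ^+ p = \sum_(i < p) r ^+ p.
    by rewrite sumr_const card_ord mulr_natl.
  by apply: ler_sum => i _; apply: ler_wiXn2l => //; [exact: ltW | exact: ltnW].
rewrite -(ltr_pM2l p0) -(ltr_pM2r r1'); apply: le_lt_trans h _.
have : y * ((1 - r) * eps) < p%:R * ((1 - r) * eps) by rewrite ltr_pM2r ?mulr_gt0.
by rewrite mulVf ?gt_eqF ?mulr_gt0 // [(1 - r) * eps]mulrC mulrA.
Qed.

(** The inverse is the Neumann series of $u=1-a$. The ultrametric inequality bounds a block of the
    series by its largest term, so the partial sums are Cauchy. *)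
Lemma banach_unit (R : realType) (B : comUnitRingType) (nm : B -> R)
    (hB : ultrametric_banach nm) (a : B) (r : R) :
  r < 1 -> nm (a - 1) <= r -> a \is a GRing.unit.
Proof.
move=> r1 har; have hnm := banach_norm hB.
have r0 : 0 <= r := le_trans (unorm_ge0 hnm _) har.
set u := 1 - a; have hu : nm u <= r by rewrite -(unormN hnm) opprB.
pose s p := \sum_(i < p) u ^+ i.
have sE p : a * s p = 1 - u ^+ p.
  by apply: oppr_inj; rewrite opprB subrX1 -mulNr /u addrAC subrr add0r.
have hs p q : (p <= q)%N -> nm (s q - s p) <= r ^+ p.
  move=> pq.
  have -> : s q - s p = \sum_(p <= i < q) u ^+ i.
    rewrite /s -!(big_mkord xpredT (fun i => u ^+ i)).
    by rewrite (big_cat_nat (n := p)) //= addrAC subrr add0r.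
  rewrite big_nat; apply: unorm_sum_le => // [|i /andP[pi _]].
    by rewrite exprn_ge0.
  by apply: le_trans (unormX_le hnm i hu) _; rewrite ler_wiXn2l // ltW.
have [|l hl] := banach_complete hB (u := s).
  move=> eps /(exprn_lt_eps r0 r1)[N hN]; exists N => p q hp hq.
  case: (leqP q p) => [|/ltnW] /hs h.
    exact: le_lt_trans h (hN _ hq).
  by rewrite -(unormN hnm) opprB; exact: le_lt_trans h (hN _ hp).
suff al : a * l - 1 = 0.
  by apply/unitrP; exists l; rewrite mulrC; move/eqP: al; rewrite subr_eq0 => /eqP ->.
apply: (banach_separated hB); apply/eqP; rewrite eq_le (unorm_ge0 hnm) andbT.
apply/ler_addgt0Pr => eps eps0; rewrite add0r.
have a1 : nm a <= 1.
  by rewrite -[a](subrK 1) unormD_le ?(unorm1 hnm) // (le_trans har) // ltW.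
have [N hN] := hl _ eps0; have [N' hN'] := exprn_lt_eps r0 r1 eps0.
pose p := maxn N N'.
(* The two terms are the distance from the partial sum to the limit and the geometric remainder; at
   this [p] both are below [eps]. *)
have -> : a * l - 1 = - (a * (s p - l)) + - u ^+ p.
  by rewrite mulrBr opprB sE; ring.
apply: unormD_le => //; rewrite (unormN hnm).
  rewrite -[eps]mul1r; apply: (unormM_le hnm) => //.
  by rewrite ltW // hN // leq_maxl.
by apply: le_trans (unormX_le hnm p hu) _; rewrite ltW // hN' // leq_maxr.
Qed.

(** * Divided powers and the inverse of $H_0(t)$ *)

Lemma unit_fact_le (B : comUnitRingType) (j n : nat) : (j < n)%N ->
  ((n.-1)`!)%:R \is a @GRing.unit B -> (j`!)%:R \is a @GRing.unit B.
Proof.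
case: n => // n; rewrite ltnS /= => jn.
rewrite -(bin_fact jn) mulnA mulnAC natrM mulrC => /unitrPr[x hx].
by apply/unitrPr; exists (('C(n, j) * (n - j)`!)%:R * x); rewrite mulrA.
Qed.

(** This is the degree $p$ part of $\exp(-t)\exp(t)=1$: after multiplication by the unit $p!$, the
    sum is the binomial expansion of $(t-t)^p$. *)
Lemma sum_divided_powersN (B : comUnitRingType) (t : B) (p : nat) :
  (p`!)%:R \is a @GRing.unit B ->
  \sum_(m < p.+1) ((- t) ^+ m / (m`!)%:R) * (t ^+ (p - m) / ((p - m)`!)%:R)
  = (p == 0%N)%:R.
Proof.
move=> up; apply: (mulrI up); rewrite mulr_sumr.
have -> : p`!%:R * (p == 0%N)%:R = (t - t) ^+ p :> B.
  by rewrite subrr expr0n; case: p {up} => [|p]; rewrite ?fact0 ?mul1r ?mulr0.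
rewrite exprDn; apply: eq_bigr => -[m /= mp] _; rewrite ltnS in mp.
have um : (m`!)%:R \is a @GRing.unit B by apply: (@unit_fact_le _ _ p.+1).
have uq : ((p - m)`!)%:R \is a @GRing.unit B.
  by apply: (@unit_fact_le _ _ p.+1) => //; rewrite ltnS leq_subr.
rewrite -(bin_fact mp) !natrM.
have -> (x y c : B) :
  c * (m`!%:R * (p - m)`!%:R) * ((x / m`!%:R) * (y / (p - m)`!%:R))
   = c * (y * x) * ((m`!%:R / m`!%:R) * ((p - m)`!%:R / (p - m)`!%:R)) by ring.
by rewrite !divrr // !mulr1 mulr_natl.
Qed.

(** $H_0(t)$ is $\exp(tN)$ for the nilpotent shift $N$. Entry $(i,k)$ only receives terms with $i\le
    j\le k$, which form the sum of [sum_divided_powersN] for $p=k-i$. *)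
Lemma H0_mulN (B : comUnitRingType) (n : nat) (t : B) :
  ((n.-1)`!)%:R \is a @GRing.unit B -> H0 n (- t) *m H0 n t = 1%:M.
Proof.
move=> un; apply/matrixP => i k; rewrite !mxE.
under eq_bigr do rewrite !mxE.
pose F j := (if (i <= j)%N then (- t) ^+ (j - i) / (j - i)`!%:R else 0)
          * (if (j <= k)%N then t ^+ (k - j) / (k - j)`!%:R else 0).
rewrite -(big_mkord xpredT F).
have [ik|ki] := leqP i k; last first.
  rewrite -val_eqE /= gtn_eqF // big1 // => j _; rewrite /F.
  case: leqP => [ij|]; last by rewrite mul0r.
  by rewrite leqNgt (leq_trans ki ij) mulr0.
have kn : (k.+1 <= n)%N by [].
rewrite (big_cat_nat (n := k.+1)) //= [X in _ + X]big_nat_cond.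
rewrite [X in _ + X]big1 => [|j]; last first.
  by rewrite andbT /F => /andP[kj _]; rewrite [(j <= k)%N]leqNgt kj mulr0.
rewrite addr0 (big_cat_nat (n := i)) //=; last exact: leqW.
rewrite [X in X + _]big_nat_cond [X in X + _]big1 => [|j]; last first.
  by rewrite andbT /F => /andP[_ ji]; rewrite [(i <= j)%N]leqNgt ji mul0r.
rewrite add0r -{1}[nat_of_ord i]add0n big_addn subSn // big_mkord.
transitivity (((k - i)%N == 0%N)%:R : B); last first.
  by rewrite subn_eq0 -val_eqE /= eqn_leq ik.
rewrite -(@sum_divided_powersN _ t); last first.
  apply: (unit_fact_le _ un); exact: leq_ltn_trans (leq_subr _ _) (ltn_ord k).
apply: eq_bigr => -[m /=]; rewrite ltnS => mk _.
by rewrite /F leq_addl addnK addnC -leq_subRL // mk subnDA.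
Qed.

(** * Derivations on divided powers *)

Section Derivation.

Variables (B : comUnitRingType) (d : {additive B -> B}).
Hypothesis hd : derivation d.

Lemma derivation1 : d 1 = 0.
Proof.
have := hd 1 1; rewrite !mul1r mulr1 => /esym/eqP.
by rewrite -subr_eq0 addrK => /eqP.
Qed.

Lemma derivation_nat k : d k%:R = 0.
Proof. by rewrite raddfMn derivation1 mul0rn. Qed.

Lemma derivation_div_nat a k : k%:R \is a @GRing.unit B -> d (a / k%:R) = d a / k%:R.
Proof.
move=> uk; apply: (mulIr uk); rewrite divrK //.
by rewrite -[in RHS](divrK uk a) [in RHS]hd derivation_nat mulr0 add0r.
Qed.

Lemma derivationX t k : d t = 1 -> d (t ^+ k.+1) = t ^+ k *+ k.+1.
Proof.
move=> ht; elim: k => [|k IH]; first by rewrite expr1 expr0.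
by rewrite exprS hd IH ht mul1r mulrnAr -exprS -mulrSr.
Qed.

Lemma derivation_divided_power t k : d t = 1 -> (k.+1`!)%:R \is a @GRing.unit B ->
  d (t ^+ k.+1 / (k.+1`!)%:R) = t ^+ k / (k`!)%:R.
Proof.
move=> ht uk; rewrite derivation_div_nat // derivationX //.
have uk' : (k`!)%:R \is a @GRing.unit B by apply: (@unit_fact_le _ _ k.+2).
apply: (mulIr uk); rewrite divrK // factS mulnC natrM mulrA divrK //.
by rewrite mulr_natr.
Qed.

(** Differentiating $t^k/k!=0$ repeatedly would end at $1=0$. With separatedness, the denominators
    $|t^j|$ of the theorem are therefore nonzero. *)
Lemma expr_antiderivative1_neq0 t k : d t = 1 -> (k`!)%:R \is a @GRing.unit B ->
  t ^+ k <> 0.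
Proof.
move=> ht; elim: k => [_ /eqP|k IH uk tk]; first by rewrite expr0 oner_eq0.
have uk' : (k`!)%:R \is a @GRing.unit B by apply: (@unit_fact_le _ _ k.+2).
apply: IH => //; rewrite -[t ^+ k](divrK uk') -derivation_divided_power //.
by rewrite tk mul0r raddf0 mul0r.
Qed.

End Derivation.

(** Coordinates are row vectors: passing from [f] to [e] multiplies them on the right by [A], so
    existence and uniqueness both come from [invmx A]. *)
Lemma is_basis_mulmx (B : comUnitRingType) (M : lmodType B) (n : nat)
    (e f : 'I_n -> M) (A : 'M[B]_n) :
  is_basis e -> A \in unitmx ->
  (forall i, f i = \sum_(j < n) A i j *: e j) -> is_basis f.
Proof.
move=> he uA hf m.
have fE (c : {ffun 'I_n -> B}) :
    \sum_i c i *: f i = \sum_j ((\row_i c i) *m A) 0 j *: e j.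
  under eq_bigr do rewrite hf scaler_sumr.
  rewrite exchange_big /=; apply: eq_bigr => j _.
  rewrite mxE scaler_suml; apply: eq_bigr => i _.
  by rewrite mxE scalerA.
have [a [am au]] := he m.
exists [ffun i => ((\row_j a j) *m invmx A) 0 i]; split.
  rewrite fE am; apply: eq_bigr => j _; congr (_ *: _).
  rewrite (_ : \row_i _ = (\row_j a j) *m invmx A) ?mulmxKV ?mxE //.
  by apply/rowP => i; rewrite !mxE ffunE mxE.
move=> c; rewrite fE => hc.
have ca : \row_j a j = (\row_i c i) *m A.
  apply/rowP => j; rewrite mxE (au [ffun j => ((\row_i c i) *m A) 0 j]) ?ffunE //.
  by rewrite hc; apply: eq_bigr => k _; rewrite ffunE.
by apply/ffunP => i; rewrite ffunE ca mulmxK // mxE.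
Qed.

(** * The vectors $c(i,j)$ and the telescoping identity *)

Section KatzCoefficients.

Variables (B : comUnitRingType) (M : lmodType B) (n : nat).
Variables (nabla : {additive M -> M}) (e : 'I_n -> M).

Definition ext0 (m : nat) : M := oapp e 0 (insub m).

Lemma ext0_ord (i : 'I_n) : ext0 i = e i.
Proof. by rewrite /ext0 valK. Qed.

Lemma ext0_ge m : (n <= m)%N -> ext0 m = 0.
Proof. by move=> nm; rewrite /ext0 insubF // ltnNge nm. Qed.

(* If S denotes the formal shift e_m |-> e_{m+1}, commuting with nabla, then
   this is S^i (S - nabla)^j e_0; the identity nabla = S - (S - nabla) is the
   recursive clause. *)
Fixpoint katz_coef (i j : nat) : M :=
  if j is j'.+1 then katz_coef i.+1 j' - nabla (katz_coef i j') else ext0 i.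

Lemma nabla_katz_coef i j :
  nabla (katz_coef i j) = katz_coef i.+1 j - katz_coef i j.+1.
Proof. by rewrite /= opprB addrC subrK. Qed.

(** This expands $(S-\nabla)^j$ by the binomial theorem; the induction step is Pascal's rule. *)
Lemma katz_coefE i j : katz_coef i j = \sum_(k < j.+1)
  ((-1) ^+ k * ('C(j, k))%:R) *: iter k nabla (ext0 (i + j - k)).
Proof.
elim: j i => [|j IH] i.
  by rewrite big_ord_recl big_ord0 addr0 /= bin0 mulr1 scale1r addn0 subn0.
have nablaZ k c m : nabla (((-1) ^+ k * c%:R) *: m) = ((-1) ^+ k * c%:R) *: nabla m.
  by rewrite -!scalerA raddfZsign !scaler_nat raddfMn.
rewrite [LHS]/= !IH [RHS]big_ord_recl /= bin0.
rewrite [X in X - _]big_ord_recl /= bin0 !subn0 addSnnS -addrA; congr (_ + _).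
(* The added term $k=j$ carries $\binom{j}{j+1}=0$; it gives both sums the same length. *)
have -> : \sum_(k < j) ((-1) ^+ bump 0 k * 'C(j, bump 0 k)%:R)
      *: nabla (iter k nabla (ext0 (i + j.+1 - bump 0 k)))
    = \sum_(k < j.+1) ((-1) ^+ k.+1 * 'C(j, k.+1)%:R)
      *: nabla (iter k nabla (ext0 (i + j.+1 - k.+1))).
  by rewrite big_ord_recr /= bin_small // mulr0 scale0r addr0.
rewrite raddf_sum -sumrB; apply: eq_bigr => k _.
rewrite /= /bump leq0n add1n addnS subSS nablaZ binS natrD mulrDr scalerDl.
by congr (_ + _); rewrite exprS mulN1r mulNr scaleNr.
Qed.

Lemma katz_vectorE t : katz_vector nabla e t
  = \sum_(j < n) (t ^+ j / (j`!)%:R) *: katz_coef 0 j.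
Proof.
apply: eq_bigr => j _; rewrite katz_coefE; congr (_ *: _).
by apply: eq_bigr => k _; rewrite add0n -(ext0_ord (ord_subn j k)).
Qed.

End KatzCoefficients.

Lemma nabla_sum_katz_coef (B : comUnitRingType) (M : lmodType B) (n : nat)
    (d : {additive B -> B}) (nabla : {additive M -> M}) (e : 'I_n -> M) (t : B) i :
  derivation d -> connection d nabla -> d t = 1 -> (0 < n)%N ->
  ((n.-1)`!)%:R \is a @GRing.unit B ->
  nabla (\sum_(j < n) (t ^+ j / (j`!)%:R) *: katz_coef nabla e i j)
  = \sum_(j < n) (t ^+ j / (j`!)%:R) *: katz_coef nabla e i.+1 j
    - (t ^+ n.-1 / (n.-1`!)%:R) *: katz_coef nabla e i n.
Proof.
move=> hd hnabla ht; case: n e => // n e _ un; rewrite raddf_sum [n.+1.-1]/=.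
pose tau j : B := t ^+ j / (j`!)%:R.
rewrite -!/(tau _); under eq_bigr do rewrite -/(tau _).
under [X in X - _]eq_bigr do rewrite -/(tau _).
set c := katz_coef nabla e.
have -> : \sum_(j < n.+1) nabla (tau j *: c i j)
   = \sum_(j < n.+1) d (tau j) *: c i j
     + (\sum_(j < n.+1) tau j *: c i.+1 j - \sum_(j < n.+1) tau j *: c i j.+1).
  rewrite -sumrB -big_split; apply: eq_bigr => j _.
  by rewrite hnabla nabla_katz_coef scalerBr.
(* The first term of the left sum vanishes since $d(1)=0$, and the last term of the subtracted sum
   is the boundary term. An index shift cancels the rest. *)
rewrite big_ord_recl [X in _ + (_ - X)]big_ord_recr.
rewrite {1}/tau expr0 fact0 divr1 derivation1 // scale0r add0r.
have -> : \sum_(j < n) d (tau (lift ord0 j)) *: c i (lift ord0 j)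
          = \sum_(j < n) tau j *: c i j.+1.
  apply: eq_bigr => j _; rewrite lift0 derivation_divided_power //.
  by apply: unit_fact_le un; rewrite ltnS.
by rewrite opprD addrCA addNKr.
Qed.

(** * Distance of the iterates of the Katz vector from the rows of $H_0(t)$ *)

Section Estimates.

Variables (R : realType) (B : comUnitRingType) (nm : B -> R).
Hypothesis hnm : ultrametric_norm nm.
Variables (M : lmodType B) (n : nat) (e : 'I_n -> M).

(* The sup-norm on M attached to the basis e, as a relation: this avoids
   choosing coordinates. *)
Definition norm_le (C : R) (m : M) : Prop :=
  exists2 c : 'I_n -> B, m = \sum_i c i *: e i & forall i, nm (c i) <= C.

Lemma norm_le0 C : 0 <= C -> norm_le C 0.
Proof.
move=> C0; exists (fun=> 0) => [|i]; last by rewrite (unorm0 hnm).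
by rewrite big1 // => i _; rewrite scale0r.
Qed.

Lemma norm_leW C C' m : C <= C' -> norm_le C m -> norm_le C' m.
Proof. by move=> CC' [c mc hc]; exists c => // i; apply: le_trans (hc i) CC'. Qed.

Lemma norm_leD C m m' : norm_le C m -> norm_le C m' -> norm_le C (m + m').
Proof.
move=> [c -> hc] [c' -> hc']; exists (fun i => c i + c' i) => [|i].
  by rewrite -big_split; apply: eq_bigr => i _; rewrite scalerDl.
exact: unormD_le.
Qed.

Lemma norm_leN C m : norm_le C m -> norm_le C (- m).
Proof.
move=> [c -> hc]; exists (fun i => - c i) => [|i]; last by rewrite unormN.
by rewrite -sumrN; apply: eq_bigr => i _; rewrite scaleNr.
Qed.

Lemma norm_leB C m m' : norm_le C m -> norm_le C m' -> norm_le C (m - m').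
Proof. by move=> hm hm'; apply: norm_leD => //; apply: norm_leN. Qed.

Lemma norm_leZ K C a m : nm a <= K -> norm_le C m -> norm_le (K * C) (a *: m).
Proof.
move=> aK [c -> hc]; exists (fun i => a * c i) => [|i]; last exact: unormM_le.
by rewrite scaler_sumr; apply: eq_bigr => i _; rewrite scalerA.
Qed.

Lemma norm_le_sum C (I : Type) (r : seq I) (P : pred I) (F : I -> M) :
  0 <= C -> (forall i, P i -> norm_le C (F i)) -> norm_le C (\sum_(i <- r | P i) F i).
Proof.
move=> C0 hF; elim/big_rec: _ => [|i x Pi hx]; first exact: norm_le0.
by apply: norm_leD => //; apply: hF.
Qed.

Variables (d : {additive B -> B}) (nabla : {additive M -> M}) (G : 'M[B]_n).
Hypotheses (hnabla : connection d nabla) (hG : connection_matrix nabla e G).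
Variables (g D : R).
Hypotheses (D1 : 1 <= D) (g0 : 0 <= g) (gD : g <= D).
Hypotheses (dD : forall b, nm (d b) <= D * nm b) (Gg : forall i j, nm (G i j) <= g).

Let D0 : 0 <= D := le_trans ler01 D1.

(** On coordinates $\nabla$ is $c\mapsto d(c)+cG$. The ultrametric inequality takes the larger of
    the two bounds, and [gD] makes [D] serve for both. *)
Lemma norm_le_nabla C m : 0 <= C -> norm_le C m -> norm_le (D * C) (nabla m).
Proof.
move=> C0 [c -> hc]; exists (fun j => d (c j) + \sum_i c i * G i j) => [|j].
  under [RHS]eq_bigr do rewrite scalerDl scaler_suml.
  rewrite raddf_sum big_split /= exchange_big -big_split; apply: eq_bigr => i _.
  rewrite hnabla hG scaler_sumr; congr (_ + _).
  by apply: eq_bigr => j _; rewrite scalerA.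
apply: unormD_le => //.
  by apply: le_trans (dD _) _; rewrite ler_wpM2l.
apply: (unorm_sum_le hnm) => [|i _]; first exact: mulr_ge0.
by rewrite mulrC unormM_le // (le_trans (Gg i j)).
Qed.

(** Basis vectors have constant coordinates, so only [G] contributes. This is the source of the
    factor [g] in the later estimates; each further $\nabla$ costs a factor [D]. *)
Lemma norm_le_nabla_ext0 m : norm_le g (nabla (ext0 e m)).
Proof.
case: (ltnP m n) => [mn|/(ext0_ge e) ->]; last by rewrite raddf0; apply: norm_le0.
by rewrite (ext0_ord e (Ordinal mn)) hG; exists (G (Ordinal mn)).
Qed.

Lemma norm_le_katz_coef i j :
  norm_le (g * D ^+ j.-1) (katz_coef nabla e i j - ext0 e (i + j)).
Proof.
elim: j i => [|j IH] i /=.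
  by rewrite addn0 subrr; apply: norm_le0; rewrite mulr_ge0 ?exprn_ge0.
have hj : D ^+ j.-1 <= D ^+ j by rewrite ler_weXn2l // leq_pred.
(* As $e_{i+(j+1)}=e_{(i+1)+j}$, the recursion passes to the errors, with source term
   $\nabla(e_{i+j})$. *)
have -> : katz_coef nabla e i.+1 j - nabla (katz_coef nabla e i j) - ext0 e (i + j.+1)
    = katz_coef nabla e i.+1 j - ext0 e (i.+1 + j)
      - nabla (katz_coef nabla e i j - ext0 e (i + j)) - nabla (ext0 e (i + j)).
  by rewrite raddfB opprB addSnnS addrA [RHS]addrAC addrK addrAC.
apply: norm_leB; last first.
  apply: (@norm_leW g); last exact: norm_le_nabla_ext0.
  by rewrite ler_peMr // exprn_ege1.
apply: norm_leB.
  by apply: norm_leW (IH _); rewrite ler_wpM2l.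
(* At $j=0$ the error is zero; the inductive bound [g] would become [D * g], one factor [D] too
   many. *)
case: j {hj} IH => [|j] IH.
  rewrite /= addn0 subrr raddf0; apply: norm_le0; exact: mulr_ge0.
rewrite exprS mulrCA; apply: norm_le_nabla (IH i).
by rewrite mulr_ge0 ?exprn_ge0.
Qed.

Variables (t : B) (h : R).
Hypotheses (hd : derivation d) (ht : d t = 1).
Hypothesis hfact : ((n.-1)`!)%:R \is a @GRing.unit B.
Hypothesis tau_le : forall j, (j < n)%N -> nm (t ^+ j / (j`!)%:R) <= h.

Let tau j : B := t ^+ j / (j`!)%:R.

Lemma norm_le_iter_katz_vector i : (0 < n)%N ->
  norm_le (h * g * D ^+ (n.-1 + i.-1))
    (iter i nabla (katz_vector nabla e t)
     - \sum_(j < n) tau j *: katz_coef nabla e i j).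
Proof.
move=> n0.
have h0 : 0 <= h by apply: le_trans (unorm_ge0 hnm _) (tau_le n0).
elim: i => [|i IH].
  by rewrite katz_vectorE subrr; apply: norm_le0; rewrite !mulr_ge0 ?exprn_ge0.
have -> : iter i.+1 nabla (katz_vector nabla e t)
    - \sum_(j < n) tau j *: katz_coef nabla e i.+1 j
  = nabla (iter i nabla (katz_vector nabla e t)
      - \sum_(j < n) tau j *: katz_coef nabla e i j)
    - tau n.-1 *: katz_coef nabla e i n.
  by rewrite raddfB (nabla_sum_katz_coef _ _ hd) // opprB addrA [RHS]addrAC addrK.
apply: norm_leB; last first.
  (* Since $e_{i+n}=0$, the boundary vector $c(i,n)$ is itself an error term, of norm at most
     $gD^{n-1}$. *)
  have := norm_le_katz_coef i n; rewrite ext0_ge ?leq_addl // subr0 => /norm_leZ-H.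
  apply: norm_leW (H _ _ (tau_le _)); last by rewrite ltn_predL.
  by rewrite mulrA ler_wpM2l ?mulr_ge0 // ler_weXn2l // leq_addr.
(* The error is zero at $i=0$, so the first step costs no factor [D]; hence the exponent [i.-1]. *)
case: i IH => [|i] IH.
  by rewrite katz_vectorE subrr raddf0; apply: norm_le0; rewrite !mulr_ge0 ?exprn_ge0.
rewrite /= addnS exprS mulrCA; apply: norm_le_nabla IH.
by rewrite !mulr_ge0 ?exprn_ge0.
Qed.

Lemma norm_le_iter_katz_vector_H0 (i : 'I_n) :
  norm_le (h * g * D ^+ (2 * n - 3))
    (iter i nabla (katz_vector nabla e t) - \sum_(j < n) H0 n t i j *: e j).
Proof.
have n0 : (0 < n)%N by apply: leq_ltn_trans (ltn_ord i).
have h0 : 0 <= h by apply: le_trans (unorm_ge0 hnm _) (tau_le n0).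
have H0E : \sum_(j < n) H0 n t i j *: e j = \sum_(j < n) tau j *: ext0 e (i + j).
  have ri : (i + (n - i) = n)%N by rewrite subnKC // ltnW.
  pose F j := (if (i <= j)%N then tau (j - i) else 0) *: ext0 e j.
  transitivity (\sum_(0 <= j < n) F j).
    by rewrite big_mkord; apply: eq_bigr => j _; rewrite mxE /F ext0_ord.
  rewrite (big_cat_nat (n := i)) //=; last exact: ltnW.
  rewrite big_nat_cond big1 ?add0r => [|j]; last first.
    by rewrite andbT /F => /andP[_ ji]; rewrite leqNgt ji scale0r.
  rewrite -(big_mkord xpredT (fun j => tau j *: ext0 e (i + j))).
  rewrite [RHS](big_cat_nat (n := n - i)) ?leq_subr //=.
  rewrite [X in _ = _ + X]big_nat_cond [X in _ = _ + X]big1 ?addr0 => [|j]; last first.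
    by rewrite andbT leq_subLR => /andP[/(ext0_ge e) ->]; rewrite scaler0.
  rewrite -{1}[nat_of_ord i]add0n big_addn; apply: eq_bigr => j _.
  by rewrite /F leq_addl addnK addnC.
rewrite H0E -[X in norm_le _ X](subrKA (\sum_(j < n) tau j *: katz_coef nabla e i j)).
(* For $n\ge 2$ the worst iterate is $i=n-1$, with $(n-1)+(n-2)=2n-3$. For $n=1$ only $i=0$ occurs,
   and its error vanishes. *)
have hexp : (n.-1 + i.-1 <= 2 * n - 3)%N \/ n = 1%N.
  by have := ltn_ord i; case: (nat_of_ord i) => [|k]; case: n => [|[|n']] //; lia.
apply: norm_leD.
  have [hi|n1] := hexp.
    apply: norm_leW (norm_le_iter_katz_vector i n0).
    by rewrite ler_wpM2l ?mulr_ge0 // ler_weXn2l.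
  have -> : (i = 0 :> nat)%N by have := ltn_ord i; lia.
  by rewrite katz_vectorE subrr; apply: norm_le0; rewrite !mulr_ge0 ?exprn_ge0.
rewrite -sumrB; apply: norm_le_sum => [|j _]; first by rewrite !mulr_ge0 ?exprn_ge0.
rewrite -scalerBr -mulrA; apply: norm_leZ; first exact: tau_le.
apply: norm_leW (norm_le_katz_coef i j).
by rewrite ler_wpM2l // ler_weXn2l //; have := ltn_ord j; lia.
Qed.

End Estimates.

(** * Norms of matrices and the constants of the smallness hypothesis *)

Lemma le_mx_supnorm (R : realType) (B : comUnitRingType) (nm : B -> R) n
    (A : 'M[B]_n) i j : nm (A i j) <= mx_supnorm nm A.
Proof.
apply: le_trans (le_bigmax _ (fun i => \big[Num.max/0]_j nm (A i j)) i).
exact: (le_bigmax _ (fun j => nm (A i j)) j).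
Qed.

Lemma opnorm_bound (R : realType) (B : comUnitRingType) (nm : B -> R)
    (d : {additive B -> B}) (b : B) : ultrametric_banach nm ->
  has_ubound (opnorm_set nm d) -> nm (d b) <= opnorm nm d * nm b.
Proof.
move=> hB hub; have hnm := banach_norm hB.
have [->|b0] := eqVneq b 0; first by rewrite raddf0 (unorm0 hnm) mulr0.
have nb : 0 < nm b.
  rewrite lt_def (unorm_ge0 hnm) andbT; apply: contra_neq b0.
  exact: (banach_separated hB).
by rewrite -ler_pdivrMr //; apply: ub_le_sup => //; exists b.
Qed.

(** Nonzero entries depend only on $j-i$, so the first row already contains them all; the default 1
    is the norm of a diagonal entry. *)
Lemma mx_supnorm_H0 (R : realType) (B : comUnitRingType) (nm : B -> R) n (t : B) :
  ultrametric_norm nm -> (0 < n)%N ->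
  mx_supnorm nm (H0 n t)
  = \big[Num.max/1]_(1 <= j < n) nm (t ^+ j / (j`!)%:R).
Proof.
move=> hnm; case: n => // n _.
have H0r (j : 'I_n.+1) : nm (t ^+ j / (j`!)%:R) <= mx_supnorm nm (H0 n.+1 t).
  by have := le_mx_supnorm nm (H0 n.+1 t) ord0 j; rewrite mxE /= subn0.
apply/le_anti/andP; split; last first.
  rewrite big_nat; apply: bigmax_le => [|j /andP[_ jn]].
    by have := H0r ord0; rewrite expr0 fact0 divr1 (unorm1 hnm).
  exact: (H0r (Ordinal jn)).
have m1 : 1 <= \big[Num.max/1]_(1 <= j < n.+1) nm (t ^+ j / (j`!)%:R).
  by elim/big_rec: _ => // j x _ x1; rewrite le_max x1 orbT.
have m0 := le_trans ler01 m1.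
apply: bigmax_le => // i _; apply: bigmax_le => // j _; rewrite mxE.
case: leqP => ij; last by rewrite (unorm0 hnm).
have [->|k0] := posnP (j - i); first by rewrite expr0 fact0 divr1 (unorm1 hnm).
pose F k := nm (t ^+ k / (k`!)%:R).
apply: (bigmax_sup_seq _ (j - i)%N _ _ F) => //.
by rewrite mem_index_iota k0 (leq_ltn_trans (leq_subr _ _)).
Qed.

(** Inversion reverses the order of positive reals. Positivity of the maximum is carried through the
    induction. *)
Lemma bigmax1V (R : realFieldType) (I : Type) (s : seq I) (P : pred I) (F G : I -> R) :
  (forall i, P i -> 0 < F i /\ (F i)^-1 = G i) ->
  (\big[Num.max/1]_(i <- s | P i) F i)^-1 = \big[Num.min/1]_(i <- s | P i) G i.
Proof.
move=> hF.
suff [] : 0 < \big[Num.max/1]_(i <- s | P i) F i /\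
  (\big[Num.max/1]_(i <- s | P i) F i)^-1 = \big[Num.min/1]_(i <- s | P i) G i by [].
elim/big_rec2: _ => [|i y x /hF[F0 <-] [x0 <-]]; first by rewrite invr1.
split; first by rewrite lt_max F0.
case: (leP (F i) x) => Fx; case: leP => //; rewrite ?ltf_pV2 ?lef_pV2 ?posrE // => h.
  by congr _^-1; apply/le_anti; rewrite Fx h.
by have := lt_trans Fx h; rewrite ltxx.
Qed.

Lemma unitmx_near_H0 (R : realType) (B : comUnitRingType) (nm : B -> R) n (t : B)
    (A : 'M[B]_n) (C : R) : ultrametric_banach nm ->
  ((n.-1)`!)%:R \is a @GRing.unit B -> 0 <= C ->
  (forall i j, nm (A i j - H0 n t i j) <= C) -> mx_supnorm nm (H0 n t) * C < 1 ->
  A \in unitmx.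
Proof.
move=> hB un C0 hA; set S := mx_supnorm _ _ => SC; have hnm := banach_norm hB.
case: n t A un hA @S SC => [|n] t A un hA S SC.
  by rewrite unitmxE det_mx00 unitr1.
have S0 : 0 <= S by apply: le_trans (unorm_ge0 hnm _) (le_mx_supnorm _ _ ord0 ord0).
(* Replacing $t$ by $-t$ only changes signs of entries, which the norm ignores. *)
have hN i j : nm (H0 n.+1 (- t) i j) <= S.
  have := le_mx_supnorm nm (H0 n.+1 t) i j; rewrite !mxE -/S.
  case: leqP => // _; rewrite exprNn -mulrA -signr_odd.
  by case: odd; rewrite ?expr1 ?expr0 ?mulN1r ?mul1r ?unormN.
suff : H0 n.+1 (- t) *m A \in unitmx by rewrite unitmx_mul => /andP[].
rewrite unitmxE; apply: (banach_unit hB SC); apply: unorm_det1_sub1 => //.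
- exact: mulr_ge0.
- exact: ltW.
move=> i j.
have -> : (H0 n.+1 (- t) *m A) i j - (i == j)%:R
    = \sum_k H0 n.+1 (- t) i k * (A k j - H0 n.+1 t k j).
  have := congr1 (fun X : 'M_n.+1 => X i j) (H0_mulN t un); rewrite /= [RHS]mxE => <-.
  by rewrite !mxE -sumrB; apply: eq_bigr => k _; rewrite mulrBr.
apply: (unorm_sum_le hnm) => [|k _]; first exact: mulr_ge0.
exact: unormM_le.
Qed.

(** The integer exponent is $-1$ at $n=1$, where the truncated one is 0. The first argument of the
    minimum serves when $o\le 1$ or $n=1$, the second otherwise. *)
Lemma min1_exprzV_le (R : realType) (o : R) (n : nat) : (0 < n)%N ->
  Num.min 1 (o ^ (2 * n%:Z - 3))^-1 <= (Num.max 1 o ^+ (2 * n - 3))^-1.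
Proof.
move=> n0; rewrite ge_min.
have [o1|o1] := leP o 1; first by rewrite expr1n invr1 lexx.
case: n n0 => [|[|n]] // _; first by rewrite /= expr0 invr1 lexx.
have -> : 2 * n.+2%:Z - 3 = (2 * n.+2 - 3)%N :> int by lia.
by rewrite -exprnP lexx orbT.
Qed.

Theorem proposition2p3 (R : realType) (B : comUnitRingType) (nm : B -> R)
    (hB : ultrametric_banach nm)
    (d : {additive B -> B}) (hd : continuous_derivation nm d)
    (n : nat) (n_gt0 : (0 < n)%N)
    (M : lmodType B) (nabla : {additive M -> M}) (hnabla : connection d nabla)
    (e : 'I_n -> M) (he : is_basis e)
    (hfact : ((n.-1)`!)%:R \is a @GRing.unit B)
    (t : B) (ht : d t = 1)
    (G1 : 'M[B]_n) (hG1 : connection_matrix nabla e G1) :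
  mx_supnorm nm (H0 n t) ^- 2
    * Num.min 1 (opnorm nm d ^ (2 * n%:Z - 3))^-1
  = (\big[Num.min/1]_(1 <= j < n) (nm (j`!)%:R / nm (t ^+ j))) ^+ 2
    * Num.min 1 (opnorm nm d ^ (2 * n%:Z - 3))^-1
  /\ (mx_supnorm nm G1 < mx_supnorm nm (H0 n t) ^- 2
        * Num.min 1 (opnorm nm d ^ (2 * n%:Z - 3))^-1 ->
      cyclic_module n nabla
      /\ cyclic_vector n nabla (katz_vector nabla e t)).
Proof.
have hnm := banach_norm hB; have [hder _ hub] := hd.
have S1 : 1 <= mx_supnorm nm (H0 n t).
  have := le_mx_supnorm nm (H0 n t) (Ordinal n_gt0) (Ordinal n_gt0).
  by rewrite mxE leqnn subnn expr0 fact0 divr1 (unorm1 hnm).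
have S0 := lt_le_trans ltr01 S1.
split.
  congr (_ * _); rewrite -exprVn; congr (_ ^+ 2).
  rewrite mx_supnorm_H0 // big_nat [RHS]big_nat; apply: bigmax1V => j /andP[_ jn].
  have uj := unit_fact_le jn hfact.
  (* The termwise inversion below requires honest, nonzero denominators. *)
  have tj : 0 < nm (t ^+ j).
    rewrite lt_def (unorm_ge0 hnm) andbT; apply/eqP => /(banach_separated hB).
    exact: expr_antiderivative1_neq0 uj.
  have jE := unorm_div_fact hnm (t ^+ j) uj.
  have j0 : 0 < nm (j`!)%:R.
    rewrite lt_def (unorm_ge0 hnm) andbT; apply: contraTneq tj => j0.
    by rewrite -jE j0 mul0r ltxx.
  have -> : nm (t ^+ j / (j`!)%:R) = nm (t ^+ j) / nm (j`!)%:R.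
    by rewrite -jE mulrAC mulfV ?mul1r // gt_eqF.
  by rewrite divr_gt0 // invf_div.
set S := mx_supnorm nm (H0 n t) in S0 S1 *; set g := mx_supnorm nm G1 => hg.
suff hc : cyclic_vector n nabla (katz_vector nabla e t).
  by split=> //; exists (katz_vector nabla e t).
(* Truncating below at 1 makes $D^k$ nondecreasing in $k$, so the single exponent $2n-3$ covers all
   iterates. *)
pose D := Num.max 1 (opnorm nm d).
have D1 : 1 <= D by rewrite le_max lexx.
have DX0 k : 0 < D ^+ k by rewrite exprn_gt0 // (lt_le_trans ltr01).
have g0 : 0 <= g.
  by apply: le_trans (unorm_ge0 hnm _) (le_mx_supnorm _ _ (Ordinal n_gt0) (Ordinal n_gt0)).
have SD0 : 0 < S ^+ 2 * D ^+ (2 * n - 3) by apply: mulr_gt0; first exact: exprn_gt0.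
have gSD : g < S ^- 2 * (D ^+ (2 * n - 3))^-1.
  apply: lt_le_trans hg _; rewrite ler_wpM2l ?invr_ge0 ?exprn_ge0 ?(ltW S0) //.
  exact: min1_exprzV_le.
have small : S * (S * g * D ^+ (2 * n - 3)) < 1.
  move: gSD; rewrite -invfM -[ltRHS]mul1r ltr_pdivlMr //.
  by congr (_ < _); ring.
(* Since $S\ge 1$ and $D\ge 1$, the smallness hypothesis already forces $g\le 1$. *)
have gD : g <= D.
  apply: (le_trans _ D1); apply: le_trans (ltW gSD) _.
  by rewrite -invfM invf_le1 //; apply: mulr_ege1; exact: exprn_ege1.
have dD b : nm (d b) <= D * nm b.
  apply: le_trans (opnorm_bound b hB hub) _.
  by rewrite ler_wpM2r ?(unorm_ge0 hnm) // le_max lexx orbT.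
have tauS j : (j < n)%N -> nm (t ^+ j / (j`!)%:R) <= S.
  move=> jn; have := le_mx_supnorm nm (H0 n t) (Ordinal n_gt0) (Ordinal jn).
  by rewrite mxE /= subn0.
have hE i := norm_le_iter_katz_vector_H0 hnm hnabla hG1 D1 g0 gD dD
  (le_mx_supnorm nm G1) hder ht hfact tauS i.
(* Choosing coordinates of each error vector gives the rows of the error matrix $E$. *)
have {hE} /choice[c hc] : forall i : 'I_n, exists c : 'I_n -> B,
    iter i nabla (katz_vector nabla e t) - \sum_(j < n) H0 n t i j *: e j
      = \sum_j c j *: e j /\ forall j, nm (c j) <= S * g * D ^+ (2 * n - 3).
  by move=> i; have [c ? ?] := hE i; exists c.
apply: (is_basis_mulmx (A := \matrix_(i, j) (H0 n t i j + c i j)) he) => [|i].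
  apply: (unitmx_near_H0 hB hfact _ _ small) => [|i j].
    by rewrite !mulr_ge0 // ltW.
  by rewrite mxE addrAC subrr add0r; have [_] := hc i.
have [/eqP] := hc i; rewrite subr_eq => /eqP -> _.
rewrite addrC -big_split; apply: eq_bigr => j _.
by rewrite [in RHS]mxE scalerDl.
Qed.
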